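(* Any nef-partition $\Pi(\Delta)$ of a reflexive polytope $\Delta$ has a unique decomposition into a direct sum of irreducible nef-partitions.
   Context: Let $M\cong\mathbb Z^d$, $N=\mathrm{Hom}(M,\mathbb Z)$. A $d$-dimensional lattice polytope $\Delta\subset M_{\mathbb R}$ is reflexive if $\Delta=\{x:\langle x,e_k\rangle\ge-1,\ k=1,\dots,n\}$ with $e_k\in N$ the primitive inward facet normals. A nef-partition $\Pi(\Delta)=\{\Delta_1,\dots,\Delta_r\}$ is a Minkowski decomposition $\Delta=\Delta_1+\dots+\Delta_r$ into lattice polytopes such that $-\min_{x\in\Delta_j}\langle x,e_k\rangle\in\{0,1\}$ for all $j,k$. $\Pi(\Delta)$ splits into a direct sum $\Pi(\Delta^{(1)})\oplus\dots\oplus\Pi(\Delta^{(k)})$ if there are lattice polytopes $\Delta^{(1)},\dots,\Delta^{(k)}\subset\Delta$ with $\Delta=\Delta^{(1)}+\dots+\Delta^{(k)}$, $d=\sum_i\dim\Delta^{(i)}$, and for each $i$: $0$ lies in the relative interior of $\Delta^{(i)}$, $\Delta^{(i)}$ is reflexive, and $\Pi(\Delta^{(i)})=\{\Delta_j:\Delta_j\subset\Delta^{(i)}\}$ is a nef-partition of $\Delta^{(i)}$. A nef-partition is reducible if there is a subset $\{k_1,\dots,k_s\}\subset\{1,\dots,r\}$ with $0<s<r$ such that $0$ lies in the relative interior of $\Delta_{k_1}+\dots+\Delta_{k_s}$; otherwise it is irreducible.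
   Formalization: Every nef-partition, including those of the summands, is required to have at least one part and no part equal to {0}; with a part {0} (e.g. [-1,1] = [-1,1] + {0}) no irreducible decomposition exists, and empty summands {0} would break uniqueness. *)

(* Defs.v *)
(* polytopes in M_R = R^d (R : realType), lattice M = Z^d,
   dual lattice N = Z^d paired with M_R by the standard dot product. *)
From mathcomp Require Import all_boot all_order all_algebra.
From mathcomp Require Import reals.
Import Order.TTheory GRing.Theory Num.Theory.
Local Open Scope ring_scope.

Definition pset (R : realType) (d : nat) := 'rV[R]_d -> Prop.

Definition lat {R : realType} {d : nat} (z : 'rV[int]_d) : 'rV[R]_d :=
  map_mx (fun a : int => a%:~R) z.

Definition pair {R : realType} {d : nat} (x : 'rV[R]_d) (e : 'rV[int]_d) : R :=
  \sum_(i < d) x 0 i * (e 0 i)%:~R.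

Definition pairZ {d : nat} (z e : 'rV[int]_d) : int :=
  \sum_(i < d) z 0 i * e 0 i.

Definition conv_pts {R : realType} {d n : nat} (p : 'I_n -> 'rV[R]_d)
    (x : 'rV[R]_d) : Prop :=
  exists l : 'I_n -> R, (forall i, 0 <= l i) /\ \sum_i l i = 1 /\
    x = \sum_i l i *: p i.

Definition lattice_polytope {R : realType} {d : nat} (P : pset R d) : Prop :=
  exists n (v : 'I_n.+1 -> 'rV[int]_d),
    forall x, P x <-> conv_pts (fun i => lat (v i)) x.

Definition lin_hull {R : realType} {d : nat} (P : pset R d) (x : 'rV[R]_d) :=
  exists n (p : 'I_n -> 'rV[R]_d) (l : 'I_n -> R),
    (forall i, P (p i)) /\ x = \sum_i l i *: p i.

Definition aff_hull {R : realType} {d : nat} (P : pset R d) (x : 'rV[R]_d) :=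
  exists n (p : 'I_n -> 'rV[R]_d) (l : 'I_n -> R),
    (forall i, P (p i)) /\ \sum_i l i = 1 /\ x = \sum_i l i *: p i.

Definition relint {R : realType} {d : nat} (P : pset R d) (x : 'rV[R]_d) :=
  P x /\ exists eps : R, 0 < eps /\
    forall y, aff_hull P y -> (forall j, `|y 0 j - x 0 j| < eps) -> P y.

Definition aff_indep {R : realType} {d n : nat} (p : 'I_n.+1 -> 'rV[R]_d) : bool :=
  row_free (\matrix_(i < n) (p (lift ord0 i) - p ord0)).

Definition has_dim {R : realType} {d : nat} (P : pset R d) (n : nat) : Prop :=
  (exists p : 'I_n.+1 -> 'rV[R]_d, (forall i, P (p i)) /\ aff_indep p) /\
  (forall m (p : 'I_m.+1 -> 'rV[R]_d), (forall i, P (p i)) -> aff_indep p ->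
     (m <= n)%N).

Definition min_face {R : realType} {d : nat} (P : pset R d) (e : 'rV[int]_d)
  : pset R d :=
  fun x => P x /\ forall y, P y -> pair x e <= pair y e.

Definition facet_normal {R : realType} {d : nat} (P : pset R d) (e : 'rV[int]_d) :=
  exists n, has_dim P n.+1 /\ has_dim (min_face P e) n.

(* e is primitive with respect to the lattice M ∩ lin(P)
   (for full-dimensional P: gcd of the coordinates of e is 1) *)
Definition prim_on {R : realType} {d : nat} (P : pset R d) (e : 'rV[int]_d) :=
  forall m : int, 1 < m ->
    ~ (forall z : 'rV[int]_d, lin_hull P (lat z) -> (m %| pairZ z e)%Z).

Definition reflexive_polytope {R : realType} {d : nat} (P : pset R d) : Prop :=
  lattice_polytope P /\
  forall x, P x <-> (lin_hull P x /\
     forall e, facet_normal P e -> prim_on P e -> -1 <= pair x e).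

Definition msum {R : realType} {d : nat} {I : finType} (J : I -> Prop)
    (D : I -> pset R d) : pset R d :=
  fun x => exists y : I -> 'rV[R]_d,
    (forall j, J j -> D j (y j)) /\ (forall j, ~ J j -> y j = 0) /\
    x = \sum_j y j.

Definition nef_partition {R : realType} {d : nat} (P : pset R d) {I : finType}
    (J : I -> Prop) (D : I -> pset R d) : Prop :=
  (exists j, J j) /\
  (forall j, J j -> lattice_polytope (D j) /\ ~ (forall x, D j x <-> x = 0)) /\
  (forall x, P x <-> msum J D x) /\
  (forall e, facet_normal P e -> prim_on P e -> forall j, J j ->
     exists c : R, (c = 0 \/ c = 1) /\
       (forall x, D j x -> - c <= pair x e) /\
       (exists x, D j x /\ pair x e = - c)).

Definition irreducible {R : realType} {d : nat} {I : finType} (J : I -> Prop)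
    (D : I -> pset R d) : Prop :=
  ~ exists S : I -> Prop,
      (forall j, S j -> J j) /\ (exists j, S j) /\ (exists j, J j /\ ~ S j) /\
      relint (msum S D) 0.

(* the nef-partition (D j)_{j < r} of Delta splits as the direct sum of the
   nef-partitions Pi(Q i) = {D j : D j ⊂ Q i}, i < k *)
Definition direct_sum_split {R : realType} {d r : nat} (Delta : pset R d)
    (D : 'I_r -> pset R d) (k : nat) (Q : 'I_k -> pset R d) : Prop :=
  (forall i x, Q i x -> Delta x) /\
  (forall i, lattice_polytope (Q i)) /\
  (forall x, Delta x <-> msum (fun _ => True) Q x) /\
  (exists n : 'I_k -> nat, (forall i, has_dim (Q i) (n i)) /\
     (\sum_(i < k) n i)%N = d) /\
  (forall i, relint (Q i) 0) /\
  (forall i, reflexive_polytope (Q i)) /\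
  (forall i, nef_partition (Q i) (fun j => forall x, D j x -> Q i x) D).

Definition irreducible_split {R : realType} {d r : nat} (Delta : pset R d)
    (D : 'I_r -> pset R d) (k : nat) (Q : 'I_k -> pset R d) : Prop :=
  direct_sum_split Delta D k Q /\
  forall i, irreducible (fun j => forall x, D j x -> Q i x) D.

(* Main.v *)
Require Import Defs.
From mathcomp Require Import all_boot all_order all_algebra.
From mathcomp Require Import boolp reals.
From mathcomp Require Import zify ring lra.

Set Implicit Arguments.
Unset Strict Implicit.
Unset Printing Implicit Defensive.
Import Order.TTheory GRing.Theory Num.Theory.
Local Open Scope ring_scope.

(** Each facet normal e of Delta takes its minimum -1 on exactly one summand
D_j, its owner, and is nonnegative on the others; the D_j contain 0 by
cancellation of Minkowski summands.  Call a set S of indices good if every e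
not owned by S vanishes on the D_j, j in S; this holds exactly when 0 lies in
the relative interior of the sum of these D_j.  Good sets are closed under
intersections, and also under complements, because Delta is a bounded
neighbourhood of 0: for x in the complementary sum, -t x decomposes as a + b
with -a a recession direction of Delta, so a = 0.  The atoms of this Boolean
algebra are the blocks of the decomposition, and the blocks of any other
decomposition into irreducible nef-partitions are again atoms that cover all
the indices. *)

(** * The pairing of M_R with N, and small vectors *)

Section Pairing.
Variables (R : realType) (d : nat).
Implicit Types (x y : 'rV[R]_d) (e : 'rV[int]_d).

Lemma pairD x y e : pair (x + y) e = pair x e + pair y e.
Proof.
by rewrite /pair -big_split /=; apply: eq_bigr => i _; rewrite mxE mulrDl.
Qed.

Lemma pair_scale (a : R) x e : pair (a *: x) e = a * pair x e.
Proof.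
by rewrite /pair mulr_sumr; apply: eq_bigr => i _; rewrite mxE mulrA.
Qed.

Lemma pair0l e : pair (0 : 'rV[R]_d) e = 0.
Proof. by rewrite /pair big1 // => i _; rewrite mxE mul0r. Qed.

Lemma pairN x e : pair (- x) e = - pair x e.
Proof. by rewrite -scaleN1r pair_scale mulN1r. Qed.

Lemma pairB x y e : pair (x - y) e = pair x e - pair y e.
Proof. by rewrite pairD pairN. Qed.

Lemma pair_sum (I : Type) (r : seq I) (P : pred I) (F : I -> 'rV[R]_d) e :
  pair (\sum_(i <- r | P i) F i) e = \sum_(i <- r | P i) pair (F i) e.
Proof.
apply: (big_morph (fun x => pair x e)) => [x y|]; [exact: pairD|exact: pair0l].
Qed.

Lemma pair_mx x e : pair x e = (x *m (lat e)^T) 0 0.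
Proof. by rewrite mxE /pair; apply: eq_bigr => i _; rewrite !mxE. Qed.

Lemma pair_lat (z e : 'rV[int]_d) :
  pair (lat z : 'rV[R]_d) e = (pairZ z e)%:~R.
Proof.
by rewrite /pair /pairZ rmorph_sum; apply: eq_bigr => i _; rewrite mxE rmorphM.
Qed.

Lemma lat_inj : injective (@lat R d).
Proof.
move=> u v uv; apply/rowP=> i; apply: (@intr_inj R).
by move/rowP/(_ i): uv; rewrite !mxE.
Qed.

Lemma latD (z w : 'rV[int]_d) : lat (z + w) = lat z + lat w :> 'rV[R]_d.
Proof. by apply/rowP=> i; rewrite !mxE rmorphD. Qed.

Lemma pair_bound (eps : R) x e : (forall j, `|x 0 j| < eps) ->
  - (eps * \sum_j `|(e 0 j)%:~R|) <= pair x e.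
Proof.
move=> h; rewrite lerNl; apply: le_trans (ler_norm _) _; rewrite normrN.
apply: le_trans (ler_norm_sum _ _ _) _; rewrite mulr_sumr.
by apply: ler_sum => j _; rewrite normrM; apply: ler_wpM2r => //; apply: ltW.
Qed.

Lemma scale_into_ball (eps : R) x : 0 < eps ->
  exists2 t : R, 0 < t & forall j, `|(t *: x) 0 j| < eps.
Proof.
move=> eps0; pose N := 1 + \sum_j `|x 0 j|.
have N0 : 0 < N by apply: ltr_wpDr => //; apply: sumr_ge0.
exists (eps / N) => [|j]; first exact: divr_gt0.
rewrite mxE normrM gtr0_norm ?divr_gt0 // mulrAC ltr_pdivrMr // ltr_pM2l //.
rewrite /N (bigD1 j) //=.
have := sumr_ge0 _ (fun (i : 'I_d) _ => normr_ge0 (x 0 i)) :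
  0 <= \sum_(i | i != j) `|x 0 i|.
lra.
Qed.

End Pairing.

(** * Convex hulls of finite families and lattice polytopes *)

Section ConvexHulls.
Variables (R : realType) (d : nat).
Implicit Types (P : pset R d).

Definition convex_set P :=
  forall n (p : 'I_n -> 'rV[R]_d), (forall i, P (p i)) ->
  forall x, conv_pts p x -> P x.

Lemma conv_pts_vertex n (p : 'I_n -> 'rV[R]_d) i : conv_pts p (p i).
Proof.
exists (fun j => (j == i)%:R); split; first by move=> j; case: eqP.
split; first by rewrite (bigD1 i) //= eqxx big1 ?addr0 // => j /negPf ->.
rewrite (bigD1 i) //= eqxx scale1r big1 ?addr0 // => j /negPf ->.
by rewrite scale0r.
Qed.

(** Nested weights multiply like matrices: outer weights times the inner weight matrix are again
    nonnegative with sum 1. *)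
Lemma conv_pts_convex n (p : 'I_n -> 'rV[R]_d) : convex_set (conv_pts p).
Proof.
move=> m q hq x [l [l0 [l1 ->]]].
have [w hw] := choice hq.
exists (fun i => \sum_k l k * w k i); split.
  by move=> i; apply: sumr_ge0 => k _; apply: mulr_ge0 => //; case: (hw k).
split.
  rewrite exchange_big /= -l1; apply: eq_bigr => k _.
  by rewrite -mulr_sumr; case: (hw k) => _ [-> _]; rewrite mulr1.
under [RHS]eq_bigr => i _ do rewrite scaler_suml.
rewrite exchange_big /=; apply: eq_bigr => k _.
case: (hw k) => _ [_ {1}->]; rewrite scaler_sumr.
by apply: eq_bigr => i _; rewrite scalerA.
Qed.

Lemma pair_conv_pts n (p : 'I_n -> 'rV[R]_d) x e (c : R) :
  conv_pts p x -> (forall i, c <= pair (p i) e) -> c <= pair x e.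
Proof.
move=> [l [l0 [l1 ->]]] h; rewrite pair_sum -[c]mul1r -l1 mulr_suml.
by apply: ler_sum => i _; rewrite pair_scale; apply: ler_wpM2l.
Qed.

Lemma lattice_polytope_convex P : lattice_polytope P -> convex_set P.
Proof.
move=> [n [v hv]] m p hp x hx; apply/hv; apply: conv_pts_convex hx => i.
exact/hv.
Qed.

Lemma lattice_polytope_ext P Q :
  (forall x, P x <-> Q x) -> lattice_polytope P -> lattice_polytope Q.
Proof.
by move=> h [n [v hv]]; exists n, v => x; rewrite -h.
Qed.

(** Allows vertices indexed by any nonempty finite type; the inhabitant [i0] makes its cardinal a
    successor. *)
Lemma lattice_polytope_fin P (I : finType) (i0 : I) (v : I -> 'rV[int]_d) :
  (forall x, P x <-> exists l : I -> R, (forall i, 0 <= l i) /\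
     \sum_i l i = 1 /\ x = \sum_i l i *: lat (v i)) ->
  lattice_polytope P.
Proof.
move=> h.
have cI : #|I|.-1.+1 = #|I| by rewrite prednK //; apply/card_gt0P; exists i0.
pose f (i : 'I_#|I|.-1.+1) : I := enum_val (cast_ord cI i).
pose g (i : I) : 'I_#|I|.-1.+1 := cast_ord (esym cI) (enum_rank i).
have fg i : f (g i) = i by rewrite /f /g cast_ordKV enum_rankK.
have gf i : g (f i) = i by rewrite /f /g enum_valK cast_ordK.
have bf : {on [pred _ | true], bijective f} by exists g => i _.
exists #|I|.-1, (v \o f) => x; rewrite h; split=> -[l [l0 [l1 lx]]].
  exists (l \o f); split; first by move=> i; apply: l0.
  split; first by rewrite -l1 (reindex f).
  by rewrite lx (reindex f).
exists (l \o g); split; first by move=> i; apply: l0.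
split; first by rewrite -l1 [LHS](reindex f) //=; apply: eq_bigr => i _; rewrite gf.
by rewrite lx [RHS](reindex f) //=; apply: eq_bigr => i _; rewrite gf.
Qed.

(** Sums of vertices generate the sum: product weights represent [a + b], and the two marginals of a
    weight on pairs split a point. *)
Lemma lattice_polytope_add P Q : lattice_polytope P -> lattice_polytope Q ->
  lattice_polytope (fun x => exists a b, P a /\ Q b /\ x = a + b).
Proof.
move=> [n [v hv]] [m [w hw]].
apply: (@lattice_polytope_fin _ ('I_n.+1 * 'I_m.+1)%type (ord0, ord0)
         (fun ij => v ij.1 + w ij.2)) => x; split.
  move=> [a [b [/hv[l [l0 [l1 ->]]] [/hw[k [k0 [k1 ->]]] ->]]]].
  exists (fun ij => l ij.1 * k ij.2); split.
    by move=> [i j]; apply: mulr_ge0.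
  split.
    rewrite -(pair_bigA _ (fun i j => l i * k j)) /= -[RHS]l1.
    by apply: eq_bigr => i _; rewrite -mulr_sumr k1 mulr1.
  rewrite -(pair_bigA _ (fun i j => (l i * k j) *: lat (v i + w j))) /=.
  under [RHS]eq_bigr => i _ do under eq_bigr => j _ do rewrite latD scalerDr.
  under [RHS]eq_bigr => i _ do rewrite big_split /=.
  rewrite big_split /=; congr (_ + _).
    by apply: eq_bigr => i _; rewrite -scaler_suml -mulr_sumr k1 mulr1.
  rewrite exchange_big /=; apply: eq_bigr => j _.
  by rewrite -scaler_suml -mulr_suml l1 mul1r.
move=> [l [l0 [l1 ->]]].
exists (\sum_i (\sum_j l (i, j)) *: lat (v i)), (\sum_j (\sum_i l (i, j)) *: lat (w j)).
have {}l1 : \sum_i \sum_j l (i, j) = 1.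
  by rewrite pair_bigA -l1; apply: eq_bigr => -[].
split; [|split].
- apply/hv; exists (fun i => \sum_j l (i, j)); split=> // i.
  by apply: sumr_ge0.
- apply/hw; exists (fun j => \sum_i l (i, j)); split; last first.
    by split=> //; rewrite exchange_big.
  by move=> j; apply: sumr_ge0.
rewrite (eq_bigr (fun ij => l (ij.1, ij.2) *: lat (v ij.1 + w ij.2))); last by case.
rewrite -(pair_bigA _ (fun i j => l (i, j) *: lat (v i + w j))) /=.
under [LHS]eq_bigr => i _ do under eq_bigr => j _ do rewrite latD scalerDr.
under [LHS]eq_bigr => i _ do rewrite big_split /=.
rewrite big_split /=; congr (_ + _).
  by apply: eq_bigr => i _; rewrite scaler_suml.
by rewrite exchange_big /=; apply: eq_bigr => i _; rewrite scaler_suml.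
Qed.

Lemma lattice_polytope0 : lattice_polytope (fun x : 'rV[R]_d => x = 0).
Proof.
have lat0 : lat 0 = 0 :> 'rV[R]_d by apply/rowP=> i; rewrite !mxE.
exists 0%N, (fun=> 0) => x; split=> [->|[l [_ [_ ->]]]]; last first.
  by rewrite big1 // => i _; rewrite lat0 scaler0.
by have := conv_pts_vertex (fun=> lat 0 : 'rV[R]_d) (ord0 : 'I_1); rewrite lat0.
Qed.

End ConvexHulls.

(** * Cancellation of Minkowski summands by a stationary distribution *)

Section Cancellation.
Variable R : realType.

(** [M - 1] kills the all-ones column, so it is singular and has a nonzero left null vector [w]; the
    normalised absolute values of [w] are the distribution. *)
Lemma stochastic_stationary n (M : 'M[R]_n.+1) :
  (forall i j, 0 <= M i j) -> (forall i, \sum_j M i j = 1) ->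
  exists p : 'I_n.+1 -> R, (forall i, 0 <= p i) /\ \sum_i p i = 1 /\
    forall j, \sum_i p i * M i j = p j.
Proof.
move=> M0 M1.
have : kermx (M - 1%:M) != 0.
  rewrite kermx_eq0 row_free_unit; apply/negP=> hu.
  have h0 : (M - 1%:M) *m (const_mx 1 : 'cV[R]_n.+1) = 0.
    apply/colP=> i; rewrite mulmxBl mul1mx !mxE.
    by under eq_bigr => j _ do rewrite mxE mulr1; rewrite M1 subrr.
  have := mulKmx hu (const_mx 1 : 'cV[R]_n.+1); rewrite h0 mulmx0.
  by move/colP/(_ ord0); rewrite !mxE => /eqP; rewrite eq_sym oner_eq0.
move/rowV0Pn=> [w /sub_kermxP]; rewrite mulmxBr mulmx1 => /eqP; rewrite subr_eq0.
move=> /eqP wM w0.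
have wE j : w 0 j = \sum_i w 0 i * M i j by rewrite -{1}wM mxE.
pose s := \sum_i `|w 0 i|.
have s0 : 0 < s.
  have [j wj] : exists j, w 0 j != 0 by apply/rV0Pn.
  by rewrite /s (bigD1 j) //= ltr_wpDr ?normr_gt0 // sumr_ge0.
(* The triangle inequality gives [|w| <= |w| M] entrywise; both sides have the same total because
   the rows of [M] sum to 1, so they are equal. *)
have aw j : \sum_i `|w 0 i| * M i j = `|w 0 j|.
  have le j' : 0 <= \sum_i `|w 0 i| * M i j' - `|w 0 j'|.
    rewrite subr_ge0 (wE j'); apply: le_trans (ler_norm_sum _ _ _) _.
    by apply: ler_sum => i _; rewrite normrM (ger0_norm (M0 _ _)).
  have tot : \sum_j' (\sum_i `|w 0 i| * M i j' - `|w 0 j'|) = 0.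
    rewrite sumrB exchange_big /=.
    by under eq_bigr => i _ do rewrite -mulr_sumr M1 mulr1; rewrite subrr.
  have := psumr_eq0P (fun i _ => le i) tot.
  by move=> /(_ j isT) /eqP; rewrite subr_eq0 => /eqP.
exists (fun i => `|w 0 i| / s); split.
  by move=> i; rewrite divr_ge0 // ltW.
split; first by rewrite -mulr_suml divff // gt_eqF.
move=> j; rewrite -aw mulr_suml; apply: eq_bigr => i _.
by rewrite mulrAC.
Qed.

(* Writing the vertices of B as b_i = a_i + \sum_k M_ik b_k and averaging
   against a stationary distribution of M gives 0 as an average of the a_i. *)
Lemma minkowski_cancel d (A : pset R d) m (b : 'I_m.+1 -> 'rV[R]_d) :
  convex_set A ->
  (forall i, exists a c, A a /\ conv_pts b c /\ b i = a + c) -> A 0.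
Proof.
move=> cA h.
have [a ha] := choice h.
have h2 i : exists l : 'I_m.+1 -> R, (forall k, 0 <= l k) /\ \sum_k l k = 1 /\
     b i = a i + \sum_k l k *: b k.
  by have [c [_ [[l [l0 [l1 ->]]] e]]] := ha i; exists l.
have [M hM] := choice h2.
have [p [p0 [p1 pM]]] := @stochastic_stationary _ (\matrix_(i, k) M i k)
  (fun i j => ltac:(by rewrite mxE; case: (hM i)))
  (fun i => ltac:(by under eq_bigr do rewrite mxE; case: (hM i) => _ [])).
apply: (cA _ a); first by move=> i; case: (ha i) => c [].
exists p; split=> //; split=> //.
have : \sum_i p i *: b i = \sum_i p i *: a i + \sum_i p i *: b i.
  rewrite {1}(eq_bigr (fun i => p i *: a i + \sum_k (p i * M i k) *: b k)).
    rewrite big_split /= [X in _ + X]exchange_big /=; congr (_ + _).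
    apply: eq_bigr => k _; rewrite -scaler_suml -[in RHS]pM; congr (_ *: _).
    by apply: eq_bigr => i _; rewrite mxE.
  move=> i _; case: (hM i) => _ [_ {1}->]; rewrite scalerDr scaler_sumr.
  by congr (_ + _); apply: eq_bigr => k _; rewrite scalerA.
by move/eqP; rewrite -subr_eq subrr => /eqP.
Qed.

End Cancellation.

(** * Minkowski sums over subsets of the indices *)

Section MinkowskiSums.
Variables (R : realType) (d : nat) (I : finType) (D : I -> pset R d).
Implicit Types (S T : {set I}) (x : 'rV[R]_d).

(** Replaces the sum over all indices, with zeros outside [S], by a sum over [S] in which the values
    outside are free. *)
Lemma msum_setP S x : msum (fun j => j \in S) D x <->
  exists y : I -> 'rV[R]_d, (forall j, j \in S -> D j (y j)) /\
    x = \sum_(j in S) y j.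
Proof.
split=> [[y [yD [y0 ->]]]|[y [yD ->]]].
  exists y; split=> //; rewrite [RHS]big_mkcond /=; apply: eq_bigr => j _.
  by case: (boolP (j \in S)) => // /negP /y0.
exists (fun j => if j \in S then y j else 0); split.
  by move=> j jS; rewrite jS; apply: yD.
split; first by move=> j /negP /negPf ->.
by rewrite big_mkcond.
Qed.

Lemma msum_allP x : msum (fun=> True) D x <->
  exists y : I -> 'rV[R]_d, (forall j, D j (y j)) /\ x = \sum_j y j.
Proof.
split=> [[y [yD [y0 ->]]]|[y [yD ->]]].
  by exists y; split=> // j; apply: yD.
by exists y; split=> //; split.
Qed.

Lemma msum_setT x : msum (fun=> True) D x <-> msum (fun j => j \in setT) D x.
Proof.
rewrite msum_allP msum_setP.
split=> -[y [yD ->]]; exists y; split=> //; last 1 first.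
- by apply: eq_bigl => j; rewrite inE.
- by apply: eq_bigl => j; rewrite inE.
by move=> j; apply: yD; rewrite inE.
Qed.

Lemma sum_setU S T (F : I -> 'rV[R]_d) : [disjoint S & T] ->
  \sum_(j in S :|: T) F j = \sum_(j in S) F j + \sum_(j in T) F j.
Proof. by move=> dST; rewrite -bigU //; apply: eq_bigl => j; rewrite !inE. Qed.

Lemma msum_setU S T x : [disjoint S & T] ->
  (msum (fun j => j \in S :|: T) D x <->
   exists a b, msum (fun j => j \in S) D a /\ msum (fun j => j \in T) D b /\
     x = a + b).
Proof.
move=> dST; split.
  move/msum_setP=> [y [yD ->]].
  exists (\sum_(j in S) y j), (\sum_(j in T) y j); split.
    by apply/msum_setP; exists y; split=> // j jS; apply: yD; rewrite inE jS.
  split; last by rewrite sum_setU.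
  by apply/msum_setP; exists y; split=> // j jS; apply: yD; rewrite inE jS orbT.
move=> [a [b [/msum_setP[y [yD ->]] [/msum_setP[z [zD ->]] ->]]]].
apply/msum_setP; exists (fun j => if j \in S then y j else z j); split.
  by move=> j; rewrite inE; case: ifP => /= [jS _|_ jT]; [exact: yD|exact: zD].
rewrite sum_setU //; congr (_ + _); apply: eq_bigr => j; first by move->.
by move=> jT; rewrite (disjointFl dST jT).
Qed.

Lemma msum_set1 j x : msum (fun i => i \in [set j]) D x <-> D j x.
Proof.
rewrite msum_setP; split=> [[y [yD ->]]|Dx].
  by rewrite big_set1; apply: yD; rewrite inE.
by exists (fun=> x); rewrite big_set1; split=> // i; rewrite inE => /eqP ->.
Qed.

Lemma msum_setC S x : msum (fun=> True) D x <->
  exists a b, msum (fun j => j \in S) D a /\ msum (fun j => j \in ~: S) D b /\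
     x = a + b.
Proof. by rewrite msum_setT -(setUCr S) msum_setU // -setI_eq0 setICr. Qed.

Lemma msum_lattice_polytope S : (forall j, lattice_polytope (D j)) ->
  lattice_polytope (msum (fun j => j \in S) D).
Proof.
move=> hD; have [n nS] := ubnP #|S|; elim: n S nS => // n IH S.
have [-> _|[j jS] nS] := set_0Vmem S.
  apply: lattice_polytope_ext (lattice_polytope0 R d) => x.
  rewrite msum_setP; split=> [->|[y [_ ->]]]; last by rewrite big_set0.
  by exists (fun=> 0); rewrite big_set0; split=> // j; rewrite inE.
have := lattice_polytope_add (hD j) (IH (S :\ j) _).
move: nS; rewrite (cardsD1 j) jS ltnS => nS /(_ nS).
apply: lattice_polytope_ext => x; rewrite -{2}(setD1K jS) msum_setU; last first.
  by rewrite -setI_eq0; apply/eqP/setP=> i; rewrite !inE; case: eqP.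
by split=> -[a [b [ha [hb ->]]]]; exists a, b; split=> //; apply/msum_set1.
Qed.

Lemma msum_subset S T x : (forall j, D j 0) -> S \subset T ->
  msum (fun j => j \in S) D x -> msum (fun j => j \in T) D x.
Proof.
move=> D0 /subsetP sST [y [yD [y0 ->]]]; exists y; split; last split=> //.
  move=> j _; case: (boolP (j \in S)) => [/yD //|/negP/y0 ->]; exact: D0.
by move=> j jT; apply: y0 => /sST.
Qed.

Lemma msum_mem S j x : (forall j, D j 0) -> j \in S -> D j x ->
  msum (fun j => j \in S) D x.
Proof.
by move=> D0 jS /msum_set1; apply: msum_subset => //; rewrite sub1set.
Qed.

Lemma pair_msum_ge0 S x e :
  (forall j y, j \in S -> D j y -> 0 <= pair y e) ->
  msum (fun j => j \in S) D x -> 0 <= pair x e.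
Proof.
move=> h /msum_setP[y [yD ->]]; rewrite pair_sum; apply: sumr_ge0 => j jS.
by apply: (h j) => //; apply: yD.
Qed.

Lemma pair_msum_eq0 S x e :
  (forall j y, j \in S -> D j y -> pair y e = 0) ->
  msum (fun j => j \in S) D x -> pair x e = 0.
Proof.
move=> h /msum_setP[y [yD ->]]; rewrite pair_sum; apply: big1 => j jS.
by apply: (h j) => //; apply: yD.
Qed.

End MinkowskiSums.

(** Backwards, the representations chosen for the fibres of [f] glue, since [j] lies only in the
    fibre over [f j]. *)
Lemma msum_regroup (R : realType) (d : nat) (I K : finType) (D : I -> pset R d)
  (f : I -> K) x : msum (fun=> True) D x <->
  msum (fun=> True) (fun i => msum (fun j => j \in [set j | f j == i]) D) x.
Proof.
split=> /msum_allP[z [zD ->]]; apply/msum_allP.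
  exists (fun i => \sum_(j in [set j | f j == i]) z j); split.
    by move=> i; apply/msum_setP; exists z.
  rewrite (partition_big f xpredT) //=; apply: eq_bigr => i _.
  by apply: eq_bigl => j; rewrite inE.
have [y hy] := choice (fun i => (msum_setP D _ _).1 (zD i)).
exists (fun j => y (f j) j); split.
  by move=> j; case: (hy (f j)) => + _; apply; rewrite inE.
rewrite [RHS](partition_big f xpredT) //=; apply: eq_bigr => i _.
case: (hy i) => _ ->; apply: eq_big => j; first by rewrite inE.
by rewrite inE => /eqP ->.
Qed.

(** * Dimension, linear span and affine independence *)

Section Dimension.
Variables (R : realType) (d : nat).
Implicit Types (P F : pset R d) (e : 'rV[int]_d).

Lemma has_dim_leq P F n m :
  (forall x, F x -> P x) -> has_dim F m -> has_dim P n -> (m <= n)%N.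
Proof.
by move=> s [[p [pF ai]] _] [_ h]; apply: h ai => i; apply/s/pF.
Qed.

Lemma has_dim_uniq P n m : has_dim P n -> has_dim P m -> n = m.
Proof.
by move=> hn hm; apply/eqP; rewrite eqn_leq !(@has_dim_leq P P).
Qed.

Lemma row_free_lincomb n (p : 'I_n -> 'rV[R]_d) :
  row_free (\matrix_i p i) <->
  (forall l : 'I_n -> R, \sum_i l i *: p i = 0 -> forall i, l i = 0).
Proof.
have E u : u *m (\matrix_i p i) = \sum_i u 0 i *: p i.
  by rewrite mulmx_sum_row; apply: eq_bigr => i _; rewrite rowK.
rewrite -kermx_eq0; split.
  move/rowV0P=> h l hl i; have := h (\row_i l i); rewrite sub_kermx E.
  under eq_bigr do rewrite mxE.
  by rewrite hl eqxx => /(_ isT) /rowP/(_ i); rewrite !mxE.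
move=> h; apply/rowV0P=> v; rewrite sub_kermx E => /eqP hv.
by apply/rowP=> i; rewrite mxE; apply: (h (fun i => v 0 i)).
Qed.

Lemma row_free_aff_indep n (p : 'I_n.+1 -> 'rV[R]_d) :
  row_free (\matrix_i p i) -> aff_indep p.
Proof.
move/row_free_lincomb=> h; apply/row_free_lincomb => l hl i.
(* An affine relation is a linear one whose coefficient at [p ord0] is minus the sum of the
   others. *)
pose q k := if unlift ord0 k is Some k' then l k' else - \sum_i l i.
have ql k : q (lift ord0 k) = l k by rewrite /q liftK.
rewrite -ql; apply: h; rewrite big_ord_recl {1}/q unlift_none.
under [X in _ + X]eq_bigr do rewrite ql.
rewrite scaleNr addrC -[RHS]hl scaler_suml -sumrB.
by apply: eq_bigr => k _; rewrite scalerBr.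
Qed.

(* Off the origin, affine and linear independence agree inside a hyperplane. *)
Lemma aff_indep_row_free n (p : 'I_n.+1 -> 'rV[R]_d) e (c : R) : c != 0 ->
  (forall i, pair (p i) e = c) -> aff_indep p -> row_free (\matrix_i p i).
Proof.
move=> c0 pc /row_free_lincomb h; apply/row_free_lincomb => l hl.
have sl : \sum_i l i = 0.
  have := congr1 (fun x => pair x e) hl; rewrite /= pair0l pair_sum.
  under [X in X = _ -> _]eq_bigr do rewrite pair_scale pc.
  by rewrite -mulr_suml => /eqP; rewrite mulf_eq0 (negPf c0) orbF => /eqP.
have hlift : forall i, l (lift ord0 i) = 0.
  apply: (h (fun i => l (lift ord0 i))).
  under eq_bigr do rewrite scalerBr.
  rewrite sumrB -scaler_suml; move: hl sl; rewrite !big_ord_recl.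
  move=> /eqP; rewrite addrC addr_eq0 => /eqP -> /eqP.
  rewrite addrC addr_eq0 => /eqP ->.
  by rewrite scaleNr opprK addrC subrr.
move=> i; case: (unliftP ord0 i) => [k ->|->]; first exact: hlift.
by move: sl; rewrite big_ord_recl big1 ?addr0.
Qed.

Lemma exists_free_rows m (V : 'M[R]_(m, d)) k : \rank V = k ->
  exists f : 'I_k -> 'I_m, row_free (\matrix_i row (f i) V).
Proof.
move=> <-; exists (maxrankfun V).
have -> : \matrix_i row (maxrankfun V i) V = rowsub (maxrankfun V) V.
  by apply/row_matrixP=> i; rewrite rowK row_rowsub.
exact: maxrowsub_free.
Qed.

(** With 0 in [P], a row basis together with 0 as base point is a maximal affinely independent
    family. *)
Lemma has_dim_span P m (V : 'M[R]_(m, d)) : P 0 ->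
  (forall x, P x -> (x <= V)%MS) -> (forall i, P (row i V)) ->
  has_dim P (\rank V).
Proof.
move=> P0 PV VP; split.
  have [f ff] := exists_free_rows (erefl (\rank V)).
  exists (fun i => if unlift ord0 i is Some k then row (f k) V else 0); split.
    by move=> i; case: unlift.
  move: ff; rewrite /aff_indep; congr (is_true (row_free _)).
  by apply/row_matrixP=> i; rewrite !rowK liftK unlift_none subr0.
move=> n p pP /eqP <-; apply: mxrankS; apply/row_subP=> i; rewrite rowK.
by apply: addmx_sub; rewrite ?eqmx_opp; apply: PV.
Qed.

(** Off the origin no extra base point is available: a row basis is itself a maximal affine family,
    so the dimension is one below the rank. *)
Lemma has_dim_hyperplane F m (V : 'M[R]_(m, d)) e c n : c != 0 ->
  (forall x, F x -> pair x e = c) ->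
  (forall x, F x -> (x <= V)%MS) -> (forall i, F (row i V)) ->
  \rank V = n.+1 -> has_dim F n.
Proof.
move=> c0 Fe FV VF rV; split.
  have [f ff] := exists_free_rows rV.
  by exists (fun i => row (f i) V); split=> //; apply: row_free_aff_indep.
move=> k p pF /(aff_indep_row_free c0 (fun i => Fe _ (pF i))) /eqP rp.
rewrite -ltnS -rV -rp; apply: mxrankS; apply/row_subP=> i; rewrite rowK.
exact: FV.
Qed.

Lemma lin_hull_rowspace P m (V : 'M[R]_(m, d)) x :
  (forall x, P x -> (x <= V)%MS) -> (forall i, P (row i V)) ->
  lin_hull P x <-> (x <= V)%MS.
Proof.
move=> PV VP; split=> [[n [p [l [pP ->]]]]|/submxP[D ->]].
  by apply: summx_sub => i _; apply: scalemx_sub; apply: PV.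
by exists m, (fun i => row i V), (fun i => D 0 i); rewrite mulmx_sum_row.
Qed.

Lemma lattice_polytope_span P : lattice_polytope P ->
  exists m (V : 'M[R]_(m, d)),
    (forall x, P x -> (x <= V)%MS) /\ (forall i, P (row i V)).
Proof.
move=> [n [v hv]]; exists n.+1, (\matrix_i lat (v i)); split.
  move=> x /hv[l [_ [_ ->]]]; apply: summx_sub => i _; apply: scalemx_sub.
  by rewrite -(rowK (fun i => lat (v i))) row_sub.
by move=> i; rewrite rowK; apply/hv/conv_pts_vertex.
Qed.

End Dimension.

(** * Primitive facet normals: uniqueness and finiteness *)

Section FacetNormals.
Variables (R : realType) (d : nat).
Implicit Types (P : pset R d) (e : 'rV[int]_d).

(** With the ratio in lowest terms [a / b], [a] divides all values of [e] and [b] all values of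
    [e']; primitivity makes both units, so the positive ratio is 1. *)
Lemma prim_on_scale P e e' (t : R) : 0 < t ->
  (forall z : 'rV[int]_d, lin_hull P (lat z) ->
     pair (lat z : 'rV[R]_d) e = t * pair (lat z : 'rV[R]_d) e') ->
  prim_on P e -> prim_on P e' -> t = 1.
Proof.
move=> t0 h pe pe'.
(* If [e'] vanished on all lattice points of the span, 2 would divide all its values. *)
have [z0 [hz0 nz]] : exists z0, lin_hull P (lat z0) /\ pairZ z0 e' != 0.
  apply/not_existsP=> hn; apply: (pe' 2) => // z hz.
  case: (eqVneq (pairZ z e') 0) => [->|zn0]; first by rewrite dvdz0.
  by case: (hn z).
have hA z : lin_hull P (lat z) -> (pairZ z e)%:~R = t * (pairZ z e')%:~R :> R.
  by move=> hz; rewrite -!pair_lat h.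
set A := pairZ z0 e; set B := pairZ z0 e'.
have An0 : A != 0.
  by rewrite -(intr_eq0 R) hA // mulf_eq0 intr_eq0 (negPf nz) gt_eqF.
have cross z : lin_hull P (lat z) -> pairZ z e * B = A * pairZ z e'.
  move=> hz; apply/eqP; rewrite -(eqr_int R) !intrM !hA //.
  by apply/eqP; ring.
pose g := gcdz A B; pose a := (A %/ g)%Z; pose b := (B %/ g)%Z.
have Ag : A = a * g by rewrite /a divzK // dvdz_gcdl.
have Bg : B = b * g by rewrite /b divzK // dvdz_gcdr.
have gn0 : g != 0 by apply: contraNneq An0; rewrite Ag => ->; rewrite mulr0.
have cab : coprimez a b.
  rewrite /coprimez; apply/eqP; apply: (mulIf gn0).
  transitivity (gcdz (a * g) (b * g)); last by rewrite -Ag -Bg mul1r.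
  by rewrite -mulz_gcdl; congr (_ * _); rewrite gez0_abs.
have cross' z : lin_hull P (lat z) -> pairZ z e * b = a * pairZ z e'.
  move=> hz; apply: (mulIf gn0); move: (cross z hz); rewrite {1}Bg {1}Ag.
  by move=> E; rewrite -mulrA E; ring.
have abs1 m e1 : m != 0 -> prim_on P e1 ->
    (forall z : 'rV[int]_d, lin_hull P (lat z) -> (m %| pairZ z e1)%Z) -> `|m| = 1.
  move=> m0 p1 h1; case: (ltrgtP 1 `|m|) => // [lt1|lt1].
    by case: (p1 `|m| lt1) => z hz; rewrite dvdzE -abszE absz_id -dvdzE; apply: h1.
  by move: m0 lt1; lia.
have a1 : `|a| = 1.
  apply: (abs1 a e) => //; first by apply: contraNneq An0; rewrite Ag => ->; rewrite mul0r.
  by move=> z hz; rewrite -(Gauss_dvdzl _ cab) cross' // dvdz_mulr.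
have b1 : `|b| = 1.
  apply: (abs1 b e') => //; first by apply: contraNneq nz; rewrite -/B Bg => ->; rewrite mul0r.
  move=> z hz; rewrite coprimez_sym in cab.
  by rewrite -(Gauss_dvdzr _ cab) -cross' // dvdz_mull.
have := hA _ hz0; rewrite -/A -/B => /(congr1 Num.norm).
rewrite normrM (gtr0_norm t0) -!intr_norm Ag Bg !normrM a1 b1 !mul1r.
move=> /eqP; rewrite -subr_eq0 -{1}[_%:~R]mul1r -mulrBl mulf_eq0 intr_eq0.
by rewrite normr_eq0 (negPf gn0) orbF subr_eq0 => /eqP.
Qed.

Lemma facet_normal_proper P e :
  facet_normal P e -> ~ (forall x, P x -> min_face P e x).
Proof.
move=> [n [h1 h2]] h; have := has_dim_leq h h1 h2.
by rewrite ltnn.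
Qed.

(** Functionals constant on the facet of [e] form a line, so [e] is a multiple of [e']; once the
    factor is positive, primitivity makes it 1. *)
Lemma facet_normal_inj P e e' : has_dim P d ->
  facet_normal P e -> facet_normal P e' -> prim_on P e -> prim_on P e' ->
  (forall x, min_face P e x -> min_face P e' x) -> e = e'.
Proof.
move=> hd fe fe' pe pe' sub.
have [n [h1 [[p [pF /eqP ai]] _]]] := fe.
have nd := has_dim_uniq h1 hd.
set B := (\matrix_(i < n) _) in ai.
have cst u : (forall i, min_face P u (p i)) -> (lat u <= kermx B^T)%MS.
  move=> hu; apply/sub_kermxP; apply/rowP=> i; rewrite !mxE.
  transitivity (pair (p (lift ord0 i) - p ord0) u).
    by apply: eq_bigr => k _; rewrite !mxE mulrC.
  have [P1 m1] := hu (lift ord0 i); have [P2 m2] := hu ord0.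
  by rewrite pairB; apply/eqP; rewrite subr_eq0 eq_le m1 // m2.
have ke := cst _ pF; have ke' := cst _ (fun i => sub _ (pF i)).
have rk : \rank (kermx B^T) = 1%N by rewrite mxrank_ker mxrank_tr ai -nd subSnn.
have e'0 : lat e' != 0 :> 'rV[R]_d.
  apply/negP=> /eqP e0; apply: (facet_normal_proper fe') => x Px; split=> // y _.
  by rewrite !pair_mx e0 trmx0 !mulmx0.
have le : (lat e <= (lat e' : 'rV[R]_d))%MS.
  apply: submx_trans ke _; rewrite -(geq_leqif (mxrank_leqif_sup ke')).
  by rewrite rk rank_rV e'0.
have [t et] := sub_rVP le.
have pt x : pair x e = t * pair x e'.
  by rewrite !pair_mx et linearZ /= -scalemxAr mxE.
have t1 : t = 1.
  apply: (@prim_on_scale P e e' t _ _ pe pe') => //.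
  (* For [t <= 0], [e] would be both minimal and maximal at [p ord0], hence constant on [P]. *)
  rewrite ltNge; apply/negP=> t0.
  apply: (facet_normal_proper fe) => x Px.
  split=> // y Py; have [P0 m0] := pF ord0; have [_ m0'] := sub _ (pF ord0).
  rewrite !pt; have := m0 _ Py; have := m0 _ Px; rewrite !pt.
  have := ler_wnM2l t0 (m0' _ Px); lra.
by apply: (@lat_inj R); rewrite et t1 scale1r.
Qed.

Lemma finite_by_fingerprint (T : eqType) (K : finType) (Q : T -> Prop) (f : T -> K) :
  (forall x y, Q x -> Q y -> f x = f y -> x = y) ->
  exists s : seq T, forall x, x \in s <-> Q x.
Proof.
move=> inj.
have h (a : K) : exists o : option T, forall x, o = Some x <-> Q x /\ f x = a.
  have [[x [qx fx]]|hn] := pselect (exists x, Q x /\ f x = a).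
    exists (Some x) => y; split=> [[<-] //|[qy fy]].
    by congr Some; apply: inj => //; rewrite fx.
  by exists None => y; split=> // hy; case: hn; exists y.
have [g hg] := choice h.
exists (pmap g (enum K)) => x; rewrite mem_pmap; split.
  by move=> /mapP[a _ /esym /hg[]].
by move=> qx; apply/mapP; exists (f x); rewrite ?mem_enum //; apply/esym/hg.
Qed.

(** The vertices that carry nonzero weight in a point of a face lie on that face themselves, so
    faces can be compared on vertices. *)
Lemma min_face_vertices n (v : 'I_n.+1 -> 'rV[int]_d) P e e' :
  (forall x, P x <-> conv_pts (fun i => lat (v i)) x) ->
  (forall i, min_face P e (lat (v i)) -> min_face P e' (lat (v i))) ->
  forall x, min_face P e x -> min_face P e' x.
Proof.
move=> hP h x [Px mx]; split=> // y Py.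
have Pv i : P (lat (v i)) by apply/hP; exact: (conv_pts_vertex (fun i => lat (v i))).
have [l [l0 [l1 xl]]] := (hP x).1 Px.
have zero : \sum_i l i * (pair (lat (v i) : 'rV[R]_d) e - pair x e) = 0.
  under eq_bigr do rewrite mulrBr -pair_scale.
  by rewrite sumrB -pair_sum -xl -mulr_suml l1 mul1r subrr.
have act i : l i != 0 -> min_face P e' (lat (v i)).
  move=> li; apply: h; split=> // z Pz.
  have := psumr_eq0P (fun i _ => mulr_ge0 (l0 i)
    (_ : 0 <= pair (lat (v i) : 'rV[R]_d) e - pair x e)) zero.
  move=> /(_ (fun i => ltac:(rewrite subr_ge0; apply: mx; apply: Pv)) i isT) /eqP.
  by rewrite mulf_eq0 (negPf li) subr_eq0 => /eqP ->; apply: mx.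
rewrite -[pair y e']mul1r -l1 mulr_suml xl pair_sum; apply: ler_sum => i _.
rewrite pair_scale; have [->|li] := eqVneq (l i) 0; first by rewrite !mul0r.
by apply: ler_wpM2l => //; case: (act i li) => _; apply.
Qed.

(** A primitive facet normal is determined by the set of vertices on its facet. *)
Lemma facet_normals_finite P : lattice_polytope P -> has_dim P d ->
  exists s : seq 'rV[int]_d, forall e, e \in s <-> facet_normal P e /\ prim_on P e.
Proof.
move=> [n [v hv]] hd.
apply: (@finite_by_fingerprint _ _ _
  (fun e => [set i | `[< min_face P e (lat (v i)) >]])) => e e' [f p] [f' p'].
move=> /setP E; apply: (facet_normal_inj hd f f' p p').
apply: (min_face_vertices hv) => i m; apply/asboolP.
by have := E i; rewrite !inE => <-; apply/asboolP.
Qed.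

End FacetNormals.

(** * Boundedness, and finite systems of facet inequalities near 0 *)

Section LatticePolytopeBounds.
Variables (R : realType) (d : nat).
Implicit Types (P : pset R d) (x : 'rV[R]_d).

Lemma lattice_polytope_bounded P : lattice_polytope P ->
  exists B : R, forall x, P x -> forall j, `|x 0 j| <= B.
Proof.
move=> [n [v hv]].
exists (\sum_i \sum_j `|(lat (v i) : 'rV[R]_d) 0 j|) => x /hv[l [l0 [l1 ->]]] j.
rewrite summxE; apply: le_trans (ler_norm_sum _ _ _) _; apply: ler_sum => i _.
rewrite mxE normrM (ger0_norm (l0 i)) (bigD1 j) //=.
apply: ler_wpDr; first exact: sumr_ge0.
apply: ler_piMl => //; rewrite -l1 (bigD1 i) //= lerDl.
by apply: sumr_ge0.
Qed.

Lemma bounded_recession0 (B : R) P x :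
  (forall y, P y -> forall j, `|y 0 j| <= B) ->
  (forall t : R, 0 <= t -> P (t *: x)) -> x = 0.
Proof.
move=> hB hx; apply/rowP=> j; rewrite [RHS]mxE; apply/eqP/contraT=> xj.
have a0 : 0 < `|x 0 j| by rewrite normr_gt0.
have B0 : 0 <= B by apply: le_trans (hB _ (hx 0 (lexx 0)) j).
(* This factor gives coordinate [j] the absolute value [B + 1]. *)
have t0 : 0 <= (B + 1) / `|x 0 j| by rewrite divr_ge0 // addr_ge0.
have := hB _ (hx _ t0) j; rewrite mxE normrM ger0_norm // divfK ?gt_eqF //.
by rewrite gerDl ler10.
Qed.

Lemma halfspaces_ball (s : seq 'rV[int]_d) : exists eps : R, 0 < eps /\
  forall x, (forall j, `|x 0 j| < eps) -> forall e, e \in s -> -1 <= pair x e.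
Proof.
pose F (e : 'rV[int]_d) : R := \sum_j `|(e 0 j)%:~R|.
have F0 e : 0 <= F e by apply: sumr_ge0.
(* [S] exceeds the l1-norm of every normal in [s], so on the cube of radius [1 / S] each takes
   values at least -1. *)
pose S := 1 + \sum_(e <- s) F e.
have S0 : 0 < S by apply: ltr_wpDr => //; apply: sumr_ge0.
exists S^-1; split; first by rewrite invr_gt0.
move=> x hx e es; apply: le_trans (pair_bound e hx).
rewrite lerN2 -/(F e) mulrC ler_pdivrMr // mul1r /S (big_rem e) //=.
have := sumr_ge0 _ (fun (i : 'rV[int]_d) _ => F0 i) : 0 <= \sum_(i <- rem e s) F i.
lra.
Qed.

(** Induction on the list: shrinking the factor is harmless, as the value at an intermediate factor
    lies between those at 1 and [1 + t]. *)
Lemma halfspaces_slack (s : seq 'rV[int]_d) x :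
  (forall e, e \in s -> -1 < pair x e) ->
  exists t : R, 0 < t /\ forall e, e \in s -> -1 <= pair ((1 + t) *: x) e.
Proof.
elim: s => [|e s IH] h; first by exists 1.
have [|t [t0 ht]] := IH; first by move=> e' es; apply: h; rewrite inE es orbT.
have he : -1 < pair x e by apply: h; rewrite inE eqxx.
(* For the value [p] of [e] at [x], the second bound gives [u * |p| <= p + 1 - u], hence
   [(1 + u) * p >= -1]. *)
pose u := Num.min t ((pair x e + 1) / (1 + `|pair x e|)).
have n0 : 0 < 1 + `|pair x e| by apply: ltr_wpDr.
have u0 : 0 < u by rewrite lt_min t0 divr_gt0 //; lra.
have ut : u <= t by rewrite ge_min lexx.
have uq : u * (1 + `|pair x e|) <= pair x e + 1.
  by rewrite -ler_pdivlMr // ge_min lexx orbT.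
exists u; split=> // e'; rewrite inE => /orP[/eqP ->|es].
  rewrite pair_scale; have := ler_norm (- pair x e); rewrite normrN => nn.
  nra.
have := ht _ es; have := h e' (mem_behead (s := e :: s) es).
rewrite !pair_scale; nra.
Qed.

End LatticePolytopeBounds.

(** * The facet data of a nef-partition *)

(** The facts on which the splitting rests: [s] lists the primitive facet normals of [Delta], and
    [own e] indexes the one summand on which [e] reaches -1. Outside [s] the value of [own] is
    arbitrary. *)
Record nef_data (R : realType) (d r : nat) (Delta : pset R d)
    (D : 'I_r -> pset R d) (s : seq 'rV[int]_d) (own : 'rV[int]_d -> 'I_r) :
    Prop := NefData {
  nd_facets : forall e, e \in s <-> facet_normal Delta e /\ prim_on Delta e;
  nd_dim : has_dim Delta d;
  nd_ineq : forall x, Delta x <-> forall e, e \in s -> -1 <= pair x e;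
  nd_pointed : forall x : 'rV[R]_d, (forall e, e \in s -> 0 <= pair x e) -> x = 0;
  nd_sum : forall x, Delta x <-> msum (fun=> True) D x;
  nd_lattice : forall j, lattice_polytope (D j);
  nd_zero : forall j, D j 0;
  nd_nonzero : forall j, exists2 x, D j x & x <> 0;
  nd_attained : forall e, e \in s -> exists x, D (own e) x /\ pair x e = -1;
  nd_ge0 : forall e j x, e \in s -> j != own e -> D j x -> 0 <= pair x e }.

Section NefData.
Variables (R : realType) (d r : nat) (Delta : pset R d) (D : 'I_r -> pset R d).

Lemma nef_partition_data : reflexive_polytope Delta -> has_dim Delta d ->
  nef_partition Delta (fun=> True) D -> exists s own, nef_data Delta D s own.
Proof.
move=> [latD hDelta] dimD [[j0 _] [hD [hsum hnef]]].
have [s hs] := facet_normals_finite latD dimD.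
(* [Delta] has full dimension, so its linear hull is everything and reflexivity reduces to the facet
   inequalities. *)
have lh x : lin_hull Delta x.
  have [m [V [DV VD]]] := lattice_polytope_span latD.
  apply/(lin_hull_rowspace x DV VD); apply: submx_full.
  have [[p [pD /eqP ai]] _] := dimD.
  rewrite /row_full eqn_leq rank_leq_col -{1}ai; apply: mxrankS.
  apply/row_subP=> i; rewrite rowK.
  by apply: addmx_sub; rewrite ?eqmx_opp; apply: DV.
have ineq x : Delta x <-> forall e, e \in s -> -1 <= pair x e.
  rewrite hDelta; split=> [[_ h] e /hs[]|h]; first exact: h.
  by split=> // e f p; apply: h; apply/hs.
have [eps [eps0 ball]] := halfspaces_ball R s.
have small (x : 'rV[R]_d) : exists2 t : R, 0 < t & Delta (t *: x).
  have [t t0 ht] := scale_into_ball x eps0.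
  by exists t => //; apply/ineq/ball.
(* A functional nonnegative on [Delta] is so on all its dilates, that is everywhere, hence is zero;
   a facet normal is not. *)
have neg e : e \in s -> exists2 x, Delta x & pair x e < 0.
  move=> es; apply: contrapT => hn.
  have ge x : Delta x -> 0 <= pair x e.
    by move=> Dx; rewrite leNgt; apply/negP=> lt; apply: hn; exists x.
  have ge' (x : 'rV[R]_d) : 0 <= pair x e.
    by have [t t0 /ge] := small x; rewrite pair_scale pmulr_rge0.
  have z (x : 'rV[R]_d) : pair x e = 0.
    by apply/eqP; rewrite eq_le ge' andbT -oppr_ge0 -pairN.
  have [/facet_normal_proper fe _] := (hs e).1 es.
  by apply: fe => x Dx; split=> // y _; rewrite !z.
(* Such an [x] is a recession direction of the bounded set [Delta]. *)
have pointed (x : 'rV[R]_d) : (forall e, e \in s -> 0 <= pair x e) -> x = 0.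
  move=> hx; have [B hB] := lattice_polytope_bounded latD.
  apply: (bounded_recession0 hB) => t t0; apply/ineq => e es.
  by rewrite pair_scale; apply: le_trans (mulr_ge0 t0 (hx _ es)); lra.
(* The minimum of [e] on [D j] is [- c j] with [c j] 0 or 1. The minimisers add up to a point of
   [Delta], so at most one [c j] is 1; [e] is negative somewhere, so at least one is. *)
have owner e : exists j, e \in s ->
    (exists x, D j x /\ pair x e = -1) /\
    (forall i x, i != j -> D i x -> 0 <= pair x e) /\
    (forall x, D j x -> -1 <= pair x e).
  case: (boolP (e \in s)) => es; last by exists j0.
  have [f p] := (hs e).1 es.
  have [c hc] := choice (fun j => hnef e f p j I).
  have [y hy] := choice (fun j => (hc j).2.2).
  have c0 i : 0 <= c i by case: (hc i) => -[->|->] _; lra.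
  have cs : \sum_j c j <= 1.
    have : Delta (\sum_j y j).
      by apply/hsum/msum_allP; exists y; split=> // j; case: (hy j).
    move/ineq/(_ e es); rewrite pair_sum.
    under eq_bigr => j _ do rewrite (hy j).2.
    by rewrite sumrN lerN2.
  have [j cj] : exists j, c j = 1.
    apply: contrapT => hn.
    have cz j : c j = 0 by case: (hc j) => -[//|cj] _; case: hn; exists j.
    have [x /hsum/msum_allP[z [zD ->]]] := neg e es.
    rewrite pair_sum ltNge => /negP; apply; apply: sumr_ge0 => j _.
    by have [_ [/(_ _ (zD j)) + _]] := hc j; rewrite cz oppr0.
  exists j => _; split; first by exists (y j); rewrite -cj; apply: hy.
  split; last by move=> x Dx; rewrite -cj; apply: (hc j).2.1.
  move=> i x ij Dx; have [ci [lb _]] := hc i; have := lb _ Dx.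
  case: ci => ci; first by rewrite ci oppr0.
  move: cs; rewrite (bigD1 j) //= (bigD1 i) //= cj ci.
  have := sumr_ge0 _ (fun (l : 'I_r) _ => c0 l) :
    0 <= \sum_(l | (l != j) && (l != i)) c l.
  lra.
have [own hown] := choice owner.
have lD j : lattice_polytope (D j) by case: (hD j I).
have zero j : D j 0.
  (* Let [B] be the sum of the other summands. Its vertices satisfy every facet inequality, so they
     lie in [Delta = D j + B]; cancelling [B] leaves 0 in [D j]. *)
  have [m [w hw]] := msum_lattice_polytope (~: [set j]) lD.
  apply: (@minkowski_cancel _ _ _ m (fun i => lat (w i))).
    exact: lattice_polytope_convex.
  move=> i.
  have : Delta (lat (w i)).
    have /msum_setP[y [yD ->]] := (hw _).2 (conv_pts_vertex (fun i => lat (w i)) i).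
    apply/ineq => e es; have [_ [h1 h2]] := hown e es.
    rewrite pair_sum; case: (boolP (own e \in ~: [set j])) => oe.
      rewrite (bigD1 (own e)) //= -[-1]addr0; apply: lerD; first exact/h2/yD.
      by apply: sumr_ge0 => k /andP[kj ko]; apply: (h1 k) => //; apply: yD.
    apply: le_trans (sumr_ge0 _ _); first by lra.
    move=> k kj; apply: (h1 k); last exact: yD.
    by apply: contraNneq oe => <-.
  move/hsum/(msum_setC _ [set j]) => [a [b [/msum_set1 Da [/hw hb ab]]]].
  by exists a, b.
exists s, own; split=> //.
- move=> j; apply: contrapT => hn; case: (hD j I) => _; apply=> x; split=> [Dx|->//].
  by apply: contrapT => x0; apply: hn; exists x.
- by move=> e es; case: (hown e es).
- by move=> e j x es jo; apply: (hown e es).2.1.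
Qed.

End NefData.

(** * The Boolean algebra of good subsets and its atoms *)

Section GoodSubsets.
Variables (R : realType) (d r : nat) (Delta : pset R d) (D : 'I_r -> pset R d).
Variables (s : seq 'rV[int]_d) (own : 'rV[int]_d -> 'I_r).
Hypothesis ND : nef_data Delta D s own.
Implicit Types (S T : {set 'I_r}) (x : 'rV[R]_d) (e : 'rV[int]_d).

Notation sumD S := (msum (fun j => j \in S) D).

(* Since D_j >= 0 on e for j != own e, this says that the cone over the sum of
   the D_j, j in S, is a linear space. *)
Definition good S := forall e, e \in s -> own e \notin S ->
  forall j x, j \in S -> D j x -> pair x e = 0.

Lemma nd_ball : exists eps : R, 0 < eps /\
  forall x, (forall j, `|x 0 j| < eps) -> Delta x.
Proof.
have [eps [eps0 h]] := halfspaces_ball R s.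
by exists eps; split=> // x /h hx; apply/(nd_ineq ND).
Qed.

Lemma nd_absorbing x : exists2 t : R, 0 < t & Delta (t *: x).
Proof.
have [eps [eps0 ball]] := nd_ball.
have [t t0 ht] := scale_into_ball x eps0.
by exists t => //; apply: ball.
Qed.

Lemma sumD_sub S x : sumD S x -> Delta x.
Proof.
move=> h; apply/(nd_sum ND)/msum_setT.
by apply: msum_subset h; [apply: nd_zero ND|apply: subsetT].
Qed.

Lemma sumD_mem S j x : j \in S -> D j x -> sumD S x.
Proof. by apply: msum_mem; apply: nd_zero ND. Qed.

Lemma sumD0 S : sumD S 0.
Proof.
apply/msum_setP; exists (fun=> 0); rewrite big1 //; split=> // j _.
exact: nd_zero ND j.
Qed.

Lemma sumD_convex S : convex_set (sumD S).
Proof.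
apply: lattice_polytope_convex; apply: msum_lattice_polytope.
exact: (nd_lattice ND).
Qed.

Lemma sumD_ge0 S e x : e \in s -> own e \notin S -> sumD S x -> 0 <= pair x e.
Proof.
move=> es oe; apply: pair_msum_ge0 => j y jS; apply: (nd_ge0 ND) => //.
by apply: contraNneq oe => <-.
Qed.

Lemma sumD_eq0 S e x : good S -> e \in s -> own e \notin S -> sumD S x ->
  pair x e = 0.
Proof. by move=> gS es oe; apply: pair_msum_eq0 => j y; apply: gS. Qed.

Lemma nd_lb e x : e \in s -> Delta x -> -1 <= pair x e.
Proof. by move=> es /(nd_ineq ND); apply. Qed.

Lemma pair_eq0_zero x : (forall e, e \in s -> pair x e = 0) -> x = 0.
Proof. by move=> h; apply: (nd_pointed ND) => e /h ->. Qed.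

Lemma goodT : good setT.
Proof. by move=> e _; rewrite inE. Qed.

Lemma goodI S T : good S -> good T -> good (S :&: T).
Proof.
move=> gS gT e es; rewrite inE negb_and => /orP[oe|oe] j x;
  rewrite inE => /andP[jS jT]; [exact: gS|exact: gT].
Qed.

Lemma goodC S : good S -> good (~: S).
Proof.
move=> gS e es oe j x jS Dx; rewrite inE negbK in oe.
have xge e' : e' \in s -> own e' \in S -> 0 <= pair x e'.
  move=> e's oe'; apply: (nd_ge0 ND) Dx => //.
  by apply: contraTneq jS => ->; rewrite inE negbK.
have [t t0] := nd_absorbing (- x).
move/(nd_sum ND)/(msum_setC _ S) => [a [b [ha [hb ab]]]].
have bge e' : e' \in s -> own e' \in S -> 0 <= pair b e'.
  by move=> e's oe'; apply: sumD_ge0 hb => //; rewrite inE negbK.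
(* [- a] equals [t x + b], which is nonnegative on the normals owned by [S]; on the others [a]
   vanishes because [S] is good. *)
have a0 : - a = 0.
  apply: (nd_pointed ND) => e' e's.
  case: (boolP (own e' \in S)) => oe'; last by rewrite pairN (sumD_eq0 gS _ _ ha) ?oppr0.
  have -> : - a = t *: x + b by rewrite -[b](addKr a) -ab scalerN addrCA subrr addr0.
  by rewrite pairD pair_scale addr_ge0 ?bge // mulr_ge0 ?xge // ltW.
(* Now [b] is a negative multiple of [x], so [e] is also at most 0 at [x]. *)
have := bge e es oe; have -> : b = t *: (- x).
  by rewrite ab -[a]opprK a0 oppr0 add0r.
rewrite pair_scale pairN pmulr_rge0 // oppr_ge0 => le.
by apply/eqP; rewrite eq_le le xge.
Qed.

(** In the splitting [x = a + b] along [S], [b] is nonnegative on the normals owned by [S] and zero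
    on the others, hence [b = 0]. *)
Lemma good_sumD_mem S x : good S -> Delta x ->
  (forall e, e \in s -> own e \notin S -> pair x e = 0) -> sumD S x.
Proof.
move=> gS /(nd_sum ND)/(msum_setC _ S)[a [b [ha [hb xab]]]] hx.
suff b0 : b = 0 by rewrite xab b0 addr0.
apply: (nd_pointed ND) => e es.
case: (boolP (own e \in S)) => oe.
  by apply: sumD_ge0 hb; rewrite // inE negbK.
have -> : b = x - a by rewrite xab addrC addKr.
by rewrite pairB hx // (sumD_eq0 gS es oe ha) subr0.
Qed.

(** From 0 one can step inside [P] to a small negative multiple of [x], where the functional must be
    nonnegative too. *)
Lemma relint0_eq0 (P : pset R d) e : relint P 0 ->
  (forall x, P x -> 0 <= pair x e) -> forall x, P x -> pair x e = 0.
Proof.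
move=> [P0 [eps [eps0 h]]] ge x Px; apply/eqP; rewrite eq_le ge // andbT.
have [t t0 ht] := scale_into_ball x eps0.
have : P (- (t *: x)).
  apply: h.
    (* The affine combination of 0 and [x] with weights [1 + t] and [- t]. *)
    exists 2%N, (fun i => if i == ord0 then 0 else x).
    exists (fun i => if i == ord0 then 1 + t else - t); split.
      by move=> i; case: eqP.
    by rewrite !big_ord_recl !big_ord0 /= scaler0 add0r !addr0 addrK scaleNr.
  by move=> j; have := ht j; rewrite !mxE subr0 normrN.
by move/ge; rewrite pairN pair_scale oppr_ge0 pmulr_rle0.
Qed.

Lemma relint_good S : relint (sumD S) 0 -> good S.
Proof.
move=> ri e es oe j x jS Dx.
by apply: (relint0_eq0 ri) (sumD_mem jS Dx) => y; apply: sumD_ge0.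
Qed.

(** The affine hull satisfies the equations that cut the sum out of [Delta], and [Delta] contains a
    ball around 0. *)
Lemma good_relint S : good S -> relint (sumD S) 0.
Proof.
move=> gS; split; first exact: sumD0.
have [eps [eps0 ball]] := nd_ball; exists eps; split=> // y [n [p [l [pS [_ yE]]]]] hy.
apply: good_sumD_mem => //.
  by apply: ball => j; have := hy j; rewrite mxE subr0.
move=> e es oe; rewrite yE pair_sum big1 // => i _.
by rewrite pair_scale (sumD_eq0 gS es oe (pS i)) mulr0.
Qed.

(** Otherwise all normals are nonnegative on [D j], which reduces it to 0. *)
Lemma exists_owned j : exists2 e, e \in s & own e = j.
Proof.
apply: contrapT => hn; have [x Dx] := nd_nonzero ND j; apply.
apply: (nd_pointed ND) => e es; apply: (nd_ge0 ND) Dx => //.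
by apply/eqP => je; apply: hn; exists e.
Qed.

Definition atom_of j : {set 'I_r} :=
  \bigcap_(S : {set 'I_r} | `[< good S >] && (j \in S)) S.

Lemma good_atom_of j : good (atom_of j).
Proof.
rewrite /atom_of; elim/big_ind: _ => [|S T|S /andP[/asboolP]] //.
  exact: goodT.
exact: goodI.
Qed.

Lemma mem_atom_of j : j \in atom_of j.
Proof. by apply/bigcapP => S /andP[]. Qed.

Lemma atom_of_min S j : good S -> j \in S -> atom_of j \subset S.
Proof. by move=> gS jS; apply: bigcap_inf; rewrite jS andbT; apply/asboolP. Qed.

(** If [j] were not in the atom of [i], removing that atom from the atom of [j] would leave a
    smaller good set containing [j]. *)
Lemma atom_of_eq i j : i \in atom_of j -> atom_of i = atom_of j.
Proof.
move=> ij; apply/eqP; rewrite eqEsubset; apply/andP; split.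
  by apply: atom_of_min ij; apply: good_atom_of.
apply: atom_of_min; first exact: good_atom_of.
apply: contraT => ji.
have /subsetP/(_ i ij) : atom_of j \subset atom_of j :&: ~: atom_of i.
  apply: atom_of_min; last by rewrite !inE mem_atom_of ji.
  by apply: goodI; [|apply: goodC]; apply: good_atom_of.
by rewrite !inE mem_atom_of andbF.
Qed.

Lemma exists_atoms : exists (k : nat) (f : 'I_r -> 'I_k), forall i,
  [/\ good [set j | f j == i], exists j, f j = i &
      forall S, good S -> S \subset [set j | f j == i] -> S != set0 ->
        S = [set j | f j == i]].
Proof.
pose K := atom_of @: [set: 'I_r].
(* Numbers the distinct atoms, so that the fibres of [f] are exactly the atoms. *)
pose f j : 'I_#|K| := enum_rank_in (imset_f atom_of (in_setT j)) (atom_of j).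
have fE j : enum_val (f j) = atom_of j.
  by rewrite /f enum_rankK_in // imset_f.
exists #|K|, f => i.
have /imsetP[j0 _ ij0] := enum_valP i.
have fj0 : f j0 = i by apply: enum_val_inj; rewrite fE.
have CE : [set j | f j == i] = atom_of j0.
  apply/setP=> j; rewrite inE; apply/eqP/idP => [fj|/atom_of_eq h].
    by rewrite -ij0 -fj fE mem_atom_of.
  by apply: enum_val_inj; rewrite fE h ij0.
rewrite CE; split; [exact: good_atom_of|by exists j0|].
move=> S gS sub /set0Pn[j jS]; apply/eqP; rewrite eqEsubset sub /=.
by rewrite -(atom_of_eq (subsetP sub _ jS)); apply: atom_of_min.
Qed.

End GoodSubsets.

(** * The direct sum along a partition into good blocks *)

Section Splitting.
Variables (R : realType) (d r : nat) (Delta : pset R d) (D : 'I_r -> pset R d).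
Variables (s : seq 'rV[int]_d) (own : 'rV[int]_d -> 'I_r).
Hypothesis ND : nef_data Delta D s own.
Variables (k : nat) (f : 'I_r -> 'I_k).
Let C (i : 'I_k) := [set j | f j == i].
Hypothesis block_good : forall i, good D s own (C i).
Hypothesis f_surj : forall i, exists j, f j = i.
Let Q (i : 'I_k) : pset R d := msum (fun j => j \in C i) D.
Implicit Types (x : 'rV[R]_d) (e : 'rV[int]_d).

Lemma block_eq0 i x e : Q i x -> e \in s -> f (own e) != i -> pair x e = 0.
Proof. by move=> Qx es oe; apply: (sumD_eq0 (@block_good i)) Qx; rewrite // inE. Qed.

Lemma block_sub i x : Q i x -> Delta x.
Proof. exact: (sumD_sub ND). Qed.

Lemma block_zero i : Q i 0.
Proof. exact: (sumD0 ND). Qed.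

Lemma block_lattice i : lattice_polytope (Q i).
Proof. by apply: msum_lattice_polytope; apply: (nd_lattice ND). Qed.

Lemma block_mem i x : Delta x ->
  (forall e, e \in s -> f (own e) != i -> pair x e = 0) -> Q i x.
Proof.
move=> Dx h; apply: (good_sumD_mem ND) => // e es.
by rewrite inE; apply: h.
Qed.

Lemma block_relint i : relint (Q i) 0.
Proof. exact: (good_relint ND (@block_good i)). Qed.

Lemma block_sum x : Delta x <-> msum (fun=> True) Q x.
Proof. by rewrite (nd_sum ND) (msum_regroup D f). Qed.

(** A summand of another block inside [Q i] would be killed by the normals of block [i], being in
    its own good block, and by all others, being in [Q i]. *)
Lemma summand_sub_block i j : (forall x, D j x -> Q i x) <-> j \in C i.
Proof.
split=> [h|jC x Dx]; last exact: (sumD_mem ND jC).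
rewrite inE; apply: contrapT => /negP ji.
have [x Dx] := nd_nonzero ND j; apply.
apply: pair_eq0_zero ND _ _ => e es.
have [oe|oe] := eqVneq (f (own e)) i; last exact: (block_eq0 (h x Dx)).
apply: (@block_eq0 (f j)) => //; first by apply: (sumD_mem ND) Dx; rewrite inE.
by rewrite oe eq_sym.
Qed.

Lemma block_summands i :
  (fun j => forall x, D j x -> Q i x) = (fun j => is_true (j \in C i)).
Proof. by apply/funext => j; apply/propext/summand_sub_block. Qed.

(** Square matrices give the spans of the blocks a common type, so that their direct sum can be
    formed. *)
Lemma block_space : exists V : 'I_k -> 'M[R]_d, forall i,
  [/\ forall x, Q i x -> (x <= V i)%MS, has_dim (Q i) (\rank (V i)) &
      forall x, (x <= V i)%MS <-> lin_hull (Q i) x].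
Proof.
suff h i : exists V : 'M[R]_d, [/\ forall x, Q i x -> (x <= V)%MS,
    has_dim (Q i) (\rank V) & forall x, (x <= V)%MS <-> lin_hull (Q i) x].
  by have [V hV] := choice h; exists V.
have [m [V [QV VQ]]] := lattice_polytope_span (block_lattice i).
exists <<V>>%MS; split.
- by move=> x /QV; rewrite genmxE.
- by rewrite genmxE; apply: has_dim_span => //; apply: block_zero.
by move=> x; rewrite genmxE; apply: iff_sym; apply: lin_hull_rowspace.
Qed.

Lemma lin_hull_eq0 i x e : lin_hull (Q i) x -> e \in s -> f (own e) != i ->
  pair x e = 0.
Proof.
move=> [n [p [l [pQ ->]]]] es oe; rewrite pair_sum big1 // => j _.
by rewrite pair_scale (block_eq0 (pQ j)) ?mulr0.
Qed.

Lemma block_dims : exists n : 'I_k -> nat, (forall i, has_dim (Q i) (n i)) /\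
  (\sum_(i < k) n i)%N = d.
Proof.
have [V hV] := block_space.
have Veq0 i x e : (x <= V i)%MS -> e \in s -> f (own e) != i -> pair x e = 0.
  by case: (hV i) => _ _ h /h; apply: lin_hull_eq0.
exists (fun i => \rank (V i)); split; first by move=> i; case: (hV i).
(* A vector in [V i] and in the sum of the other spans is killed by every normal: by those of block
   [i] through the second membership, by the rest through the first. *)
have dV : mxdirect (\sum_i V i).
  apply/mxdirect_sumsP => i _; apply/eqP/rowV0P => x; rewrite sub_capmx.
  move=> /andP[xi /sub_sumsmxP[u xu]]; apply: (pair_eq0_zero ND) => e es.
  have [oe|] := eqVneq (f (own e)) i; last exact: Veq0.
  rewrite xu pair_sum big1 // => j ji; apply: (Veq0 j) => //.
    exact: submxMl.
  by rewrite oe eq_sym.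
rewrite -(mxdirectP dV) /=; apply/eqP; rewrite -/(row_full _) -sub1mx.
(* A positive multiple of each unit vector lies in [Delta], so it is a sum of points of the
   blocks. *)
apply/row_subP => l; have [t t0 /block_sum/msum_allP[y [yQ ty]]] :=
  nd_absorbing ND (row l 1%:M).
rewrite -[row l _](scalerK (lt0r_neq0 t0)) ty; apply: scalemx_sub.
apply: summx_sub => i _; apply: (sumsmx_sup i) => //.
by case: (hV i) => h _ _; apply: h.
Qed.

(* Projecting a basis of R^d taken from the facet of Delta cut out by e to the
   block that owns e yields a spanning set of the facet of that block. *)
Lemma block_facet_normal e : e \in s -> facet_normal (Q (f (own e))) e.
Proof.
move=> es; set i0 := f (own e).
have [[n [h1 [[p [pF ai]] _]]] _] := (nd_facets ND e).1 es.
have nd : n.+1 = d := has_dim_uniq h1 (nd_dim ND).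
have [x0 [Dx0 x0e]] := nd_attained ND es.
have Qx0 : Q i0 x0 by apply: (sumD_mem ND) Dx0; rewrite inE.
have pe l : pair (p l) e = -1.
  have [Dp mp] := pF l; apply/eqP; rewrite eq_le (nd_lb ND es Dp) andbT -x0e.
  exact/mp/(block_sub Qx0).
have N1 : -1 != 0 :> R by rewrite oppr_eq0 oner_eq0.
(* The [p l] lie on a hyperplane off the origin, so [d] affinely independent ones form a basis. *)
have full : row_full (\matrix_l p l).
  by rewrite /row_full -[X in _ == X]nd; exact: aff_indep_row_free N1 pe ai.
have [q hq] := choice (fun l => (msum_allP Q (p l)).1
  ((block_sum _).1 (proj1 (pF l)))).
pose W := \matrix_l q l i0.
have qe l : pair (q l i0) e = -1.
  rewrite -(pe l) (hq l).2 pair_sum (bigD1 i0) //= big1 ?addr0 // => i ii0.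
  by apply: (block_eq0 ((hq l).1 i)) => //; rewrite eq_sym.
have WQ l : Q i0 (row l W) by rewrite rowK; apply: (hq l).1.
(* The coordinates of [x] in the basis [p] also express it in the projections [q l i0]: both sides
   agree on every normal. *)
have QW x : Q i0 x -> (x <= W)%MS.
  move=> Qx; have /submxP[c xc] := submx_full x full.
  have xc' : x = \sum_l c 0 l *: p l.
    by rewrite xc mulmx_sum_row; apply: eq_bigr => l _; rewrite rowK.
  suff -> : x = c *m W by apply: submxMl.
  apply/eqP; rewrite -subr_eq0; apply/eqP/(pair_eq0_zero ND) => e' e's.
  rewrite pairB mulmx_sum_row; have [oe|oe] := eqVneq (f (own e')) i0; last first.
    rewrite (block_eq0 Qx) // pair_sum big1 ?subrr // => l _.
    by rewrite pair_scale (block_eq0 (WQ l)) ?mulr0.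
  rewrite xc' !pair_sum -sumrB big1 // => l _.
  rewrite !pair_scale rowK (hq l).2 pair_sum (bigD1 i0) //= big1 ?addr0 ?subrr //.
  by move=> i ii0; apply: (block_eq0 ((hq l).1 i)) => //; rewrite oe eq_sym.
have hW : has_dim (Q i0) (\rank W) by apply: has_dim_span => //; apply: block_zero.
have FE x : min_face (Q i0) e x -> pair x e = -1.
  move=> [Qx mx]; apply/eqP; rewrite eq_le (nd_lb ND es (block_sub Qx)) andbT.
  by rewrite -x0e; apply: mx.
have rW : (\rank W).-1.+1 = \rank W.
  rewrite prednK // lt0n mxrank_eq0; apply/negP => /eqP W0.
  by have := qe ord0; rewrite -(rowK (fun l => q l i0)) -/W W0 row0 pair0l; lra.
exists (\rank W).-1; split; first by rewrite rW.
apply: (has_dim_hyperplane N1 FE (V := W)) => //; first by move=> x [/QW].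
move=> l; split=> // y Qy; rewrite rowK qe; exact: (nd_lb ND es (block_sub Qy)).
Qed.

(** Some vertex of the block has value -1 on [e], so only units divide all values. *)
Lemma block_prim_on e : e \in s -> prim_on (Q (f (own e))) e.
Proof.
move=> es m m1 h.
have [n [v hv]] := block_lattice (f (own e)).
have Qv i : Q (f (own e)) (lat (v i)).
  by apply/hv; exact: (conv_pts_vertex (fun i => lat (v i))).
(* Vertices have integer values at least -1; if none were -1, [e] would be nonnegative on the block,
   which contains [x0]. *)
have [i vi] : exists i, pairZ (v i) e = -1.
  apply: contrapT => hn.
  have [x0 [Dx0 x0e]] := nd_attained ND es.
  have /hv Qx0 : Q (f (own e)) x0 by apply: (sumD_mem ND) Dx0; rewrite inE.
  have := pair_conv_pts (c := 0) Qx0 (e := e); rewrite x0e ler0N1.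
  suff h0 i : 0 <= pair (lat (v i) : 'rV[R]_d) e by move=> /(_ h0).
  have := nd_lb ND es (block_sub (Qv i)); rewrite pair_lat ler0z.
  rewrite -[X in X <= _]mulrN1z ler_int => ge.
  have : pairZ (v i) e != -1 by apply/eqP => E; apply: hn; exists i.
  by move: ge; lia.
have : (m %| pairZ (v i) e)%Z.
  apply: h; exists 1%N, (fun=> lat (v i)), (fun=> 1); split=> //.
  by rewrite big_ord_recl big_ord0 addr0 scale1r.
by rewrite vi dvdzE dvdn1 => /eqP; move: m1; lia.
Qed.

(* A facet of a block lies in a facet of Delta: otherwise its barycentre could
   be pushed outwards inside the block. *)
Lemma block_facet_owner i e : facet_normal (Q i) e -> prim_on (Q i) e ->
  exists e', [/\ e' \in s, f (own e') = i &
    forall x, lin_hull (Q i) x -> pair x e = pair x e'].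
Proof.
move=> fe pe; have [n [h1 [[p [pF ai]] _]]] := fe.
have [V hV] := block_space; have [QV dV lV] := hV i.
have rV := has_dim_uniq h1 dV.
pose c := pair (p ord0) e.
have cle x : Q i x -> c <= pair x e by move=> Qx; case: (pF ord0) => _; apply.
have pc l : pair (p l) e = c.
  by have [Qp mp] := pF l; apply/eqP; rewrite eq_le cle // andbT mp //; case: (pF ord0).
(* As 0 is in the relative interior, a minimum of 0 would make [e] vanish on the whole block,
   against properness of the facet. *)
have c0 : c < 0.
  rewrite lt_neqAle -[X in _ <= X](pair0l R e) cle ?andbT; last exact: block_zero.
  apply/negP => /eqP c0; apply: (facet_normal_proper fe) => x Qx; split=> // y Qy.
  have z := relint0_eq0 (block_relint i) (e := e).
  by rewrite c0 in cle; rewrite !z.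
have fp := aff_indep_row_free (ltr0_neq0 c0) pc ai.
have Vp x : (x <= V i)%MS -> exists l : 'I_n.+1 -> R, x = \sum_j l j *: p j.
  have pV : (\matrix_j p j <= V i)%MS.
    by apply/row_subP => j; rewrite rowK; apply: QV; case: (pF j).
  have /submx_trans tr : (V i <= \matrix_j p j)%MS.
    by rewrite -(geq_leqif (mxrank_leqif_sup pV)) (eqP fp) rV.
  move=> xV; have /submxP[u ->] : (x <= \matrix_j p j)%MS.
    by apply: submx_trans xV _; apply: tr.
  exists (fun j => u 0 j); rewrite mulmx_sum_row; apply: eq_bigr => j _.
  by rewrite rowK.
pose a : R := n.+1%:R^-1.
have a0 : 0 < a by rewrite invr_gt0 ltr0n.
have a1 : \sum_(j < n.+1) a = 1.
  by rewrite sumr_const card_ord -[LHS]mulr_natl divff // pnatr_eq0.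
pose b := \sum_j a *: p j.
have Qb : Q i b.
  apply: (sumD_convex ND (p := p)); first by move=> j; case: (pF j).
  by exists (fun=> a); split=> // j; apply: ltW.
have be : pair b e = c.
  rewrite pair_sum; under eq_bigr do rewrite pair_scale pc.
  by rewrite -mulr_suml a1 mul1r.
have [e' [e's oe' be']] : exists e', [/\ e' \in s, f (own e') = i & pair b e' = -1].
  apply: contrapT => hn.
  have gt e' : e' \in s -> -1 < pair b e'.
    move=> e's; have lb := nd_lb ND e's (block_sub Qb).
    rewrite lt_neqAle lb andbT eq_sym; apply/negP => /eqP be'.
    have [oe|oe] := eqVneq (f (own e')) i; first by apply: hn; exists e'.
    by move: be'; rewrite (block_eq0 Qb) //; lra.
  have [t [t0 ht]] := halfspaces_slack gt.
  have /cle : Q i ((1 + t) *: b).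
    apply: block_mem; first exact/(nd_ineq ND).
    by move=> e' e's oe; rewrite pair_scale (block_eq0 Qb) ?mulr0.
  by rewrite pair_scale be; nra.
(* An average of values that are at least -1 equals -1 only if each of them does. *)
have pe' l : pair (p l) e' = -1.
  have ge j : 0 <= a * (pair (p j) e' + 1).
    apply: mulr_ge0; first exact: ltW.
    by have := nd_lb ND e's (block_sub (proj1 (pF j))); lra.
  have tot : \sum_j a * (pair (p j) e' + 1) = 0.
    under eq_bigr do rewrite mulrDr -pair_scale mulr1.
    by rewrite big_split /= -pair_sum a1 -/b be' addNr.
  have := psumr_eq0P (fun j _ => ge j) tot; move=> /(_ l isT) /eqP.
  by rewrite mulf_eq0 (gt_eqF a0) /= => /eqP; lra.
(* The two functionals agree on the [p l], which span the linear hull of the block. *)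
have prop x : lin_hull (Q i) x -> pair x e = - c * pair x e'.
  move=> /lV/Vp[l ->]; rewrite !pair_sum mulr_sumr; apply: eq_bigr => j _.
  by rewrite !pair_scale pc pe'; ring.
have c1 : - c = 1.
  apply: (prim_on_scale _ _ pe (e' := e')); first by rewrite oppr_gt0.
    by move=> z; apply: prop.
  by rewrite -oe'; apply: block_prim_on.
by exists e'; split=> // x /prop; rewrite c1 mul1r.
Qed.

Lemma mem_lin_hull (P : pset R d) x : P x -> lin_hull P x.
Proof.
by exists 1%N, (fun=> x), (fun=> 1); rewrite big_ord_recl big_ord0 addr0 scale1r.
Qed.

(** On the span of the block, its primitive facet normals agree with normals of [Delta] owned by the
    block; conversely those are primitive facet normals of it, and the remaining ones vanish
    there. *)
Lemma block_reflexive i : reflexive_polytope (Q i).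
Proof.
split; first exact: block_lattice.
move=> x; split=> [Qx|[lx h]].
  split; first exact: mem_lin_hull.
  move=> e fe pe; have [e' [e's _ ->]] := block_facet_owner fe pe.
    exact: (nd_lb ND e's (block_sub Qx)).
  exact: mem_lin_hull.
apply: block_mem; last by move=> e; apply: lin_hull_eq0.
apply/(nd_ineq ND) => e es; have [oe|oe] := eqVneq (f (own e)) i.
  by apply: h; rewrite -oe; [apply: block_facet_normal|apply: block_prim_on].
by rewrite (lin_hull_eq0 lx) // lerN10.
Qed.

Lemma nef_summand_nontrivial j : ~ (forall x, D j x <-> x = 0).
Proof. by move=> h; have [x /h] := nd_nonzero ND j. Qed.

Lemma block_nef_partition i :
  nef_partition (Q i) (fun j => forall x, D j x -> Q i x) D.
Proof.
rewrite block_summands; split.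
  by have [j fj] := f_surj i; exists j; rewrite inE fj.
split; first by move=> j _; split; [apply: (nd_lattice ND)|apply: nef_summand_nontrivial].
split=> // e fe pe j jC; have [e' [e's oe' E]] := block_facet_owner fe pe.
have Ej x : D j x -> pair x e = pair x e'.
  by move=> Dx; apply/E/mem_lin_hull/(sumD_mem ND jC).
(* The minimum is -1 on the owner of [e'], and 0, attained at the origin, on the other summands of
   the block. *)
have [je|je] := eqVneq j (own e').
  exists 1; split; first by right.
  split; first by move=> x Dx; rewrite Ej //;
    exact: (nd_lb ND e's (block_sub (sumD_mem ND jC Dx))).
  by have [x [Dx xe]] := nd_attained ND e's; rewrite je; exists x; rewrite Ej // je.
exists 0; split; first by left.
split; first by move=> x Dx; rewrite Ej // oppr0; apply: (nd_ge0 ND) Dx.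
by exists 0; rewrite pair0l oppr0; split=> //; apply: (nd_zero ND).
Qed.

Lemma block_direct_sum_split : direct_sum_split Delta D k Q.
Proof.
split; first exact: block_sub.
split; first exact: block_lattice.
split; first exact: block_sum.
split; first exact: block_dims.
split; first exact: block_relint.
split; first exact: block_reflexive.
exact: block_nef_partition.
Qed.

(** A proper part whose sum has 0 in its relative interior would be a smaller good set. *)
Lemma block_irreducible i :
  (forall S, good D s own S -> S \subset C i -> S != set0 -> S = C i) ->
  irreducible (fun j => forall x, D j x -> Q i x) D.
Proof.
rewrite block_summands => minC [S [SC [[j Sj] [[l [lC nSl]] ri]]]].
pose S' := [set j | `[< S j >]].
have SE : S = (fun j => is_true (j \in S')).
  by apply/funext => a; apply/propext; rewrite inE; split=> /asboolP.
have S'E : S' = C i.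
  apply: minC; first by rewrite SE in ri; apply: (relint_good ND) ri.
    by apply/subsetP => a; rewrite inE => /asboolP /SC.
  by apply/set0Pn; exists j; rewrite inE; apply/asboolP.
by apply: nSl; rewrite SE S'E.
Qed.

End Splitting.

(** * Uniqueness of the irreducible splitting *)

Section Uniqueness.
Variables (R : realType) (d r : nat) (Delta : pset R d) (D : 'I_r -> pset R d).
Variables (s : seq 'rV[int]_d) (own : 'rV[int]_d -> 'I_r).
Hypothesis ND : nef_data Delta D s own.
Variables (k : nat) (Q : 'I_k -> pset R d).
Hypothesis split_Q : irreducible_split Delta D k Q.

Definition summands (i : 'I_k) : {set 'I_r} :=
  [set j | `[< forall x, D j x -> Q i x >]].

Lemma summandsE i :
  (fun j => forall x, D j x -> Q i x) = (fun j => is_true (j \in summands i)).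
Proof. by apply/funext => j; apply/propext; rewrite inE; split=> /asboolP. Qed.

(** Comparing splittings thus reduces to comparing index sets. *)
Lemma split_block i : Q i = msum (fun j => j \in summands i) D.
Proof.
have [[_ [_ [_ [_ [_ [_ nef]]]]]] _] := split_Q.
have [_ [_ [h _]]] := nef i.
by apply/funext => x; apply/propext; rewrite h summandsE.
Qed.

Lemma summands_good i : good D s own (summands i).
Proof.
have [[_ [_ [_ [_ [ri _]]]]] _] := split_Q.
by apply: (relint_good ND); rewrite -split_block.
Qed.

Lemma summands_nonempty i : exists j, j \in summands i.
Proof.
have [[_ [_ [_ [_ [_ [_ nef]]]]]] _] := split_Q.
by have [[j hj] _] := nef i; exists j; rewrite inE; apply/asboolP.
Qed.

(** A proper nonempty good subset has 0 in the relative interior of its sum, against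
    irreducibility. *)
Lemma summands_min i S : good D s own S -> S \subset summands i ->
  S != set0 -> S = summands i.
Proof.
move=> gS sub /set0Pn[j jS]; apply/eqP; rewrite eqEsubset sub /=.
apply/subsetP => l lC; apply: contraT => lS.
have [_ /(_ i)] := split_Q; rewrite summandsE; case.
exists (fun j => j \in S); split; first by move=> a; apply: (subsetP sub).
split; first by exists j.
split; first by exists l; split=> //; apply/negP.
exact: (good_relint ND).
Qed.

(** A normal owned by an uncovered index would be nonnegative on every block, hence on [Delta],
    where it does reach -1. *)
Lemma summands_cover j : exists i, j \in summands i.
Proof.
apply: contrapT => hn; have [e es oe] := exists_owned ND j.
have [[_ [_ [hsum _]]] _] := split_Q.
have [x0 [Dx0 x0e]] := nd_attained ND es.
have /hsum/msum_allP[y [yQ x0y]] : Delta x0.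
  by apply: (sumD_sub ND (S := [set own e])); apply/msum_set1.
have : 0 <= pair x0 e.
  rewrite x0y pair_sum; apply: sumr_ge0 => i _.
  have := yQ i; rewrite split_block; apply: (sumD_ge0 ND) => //.
  by rewrite oe; apply/negP => h; apply: hn; exists i.
by rewrite x0e ler0N1.
Qed.

End Uniqueness.

Theorem mainTheorem6 (R : realType) (d r : nat) (Delta : pset R d)
    (D : 'I_r -> pset R d) :
  reflexive_polytope Delta -> has_dim Delta d ->
  nef_partition Delta (fun _ => True) D ->
  exists (k : nat) (Q : 'I_k -> pset R d),
    irreducible_split Delta D k Q /\
    forall (k' : nat) (Q' : 'I_k' -> pset R d),
      irreducible_split Delta D k' Q' ->
      (forall i, exists i', Q i = Q' i') /\ (forall i', exists i, Q' i' = Q i).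
Proof.
move=> hrefl hdim hnef.
have [s [own ND]] := nef_partition_data hrefl hdim hnef.
have [k [f hf]] := exists_atoms ND.
have gC i : good D s own [set j | f j == i] by case: (hf i).
have fs i : exists j, f j = i by case: (hf i).
exists k, (fun i => msum (fun j => j \in [set j | f j == i]) D); split.
  split; first exact: (block_direct_sum_split ND).
  by move=> i; apply: (block_irreducible ND) => //; case: (hf i).
move=> k' Q' split'.
(* Two atoms with a common index [j] both equal their intersection, which is good and nonempty. *)
have same j i' : j \in summands D Q' i' -> summands D Q' i' = [set l | f l == f j].
  move=> ji; have gS := summands_good ND split' (i := i').
  have gI := goodI gS (gC (f j)).
  have n0 : summands D Q' i' :&: [set l | f l == f j] != set0.
    by apply/set0Pn; exists j; rewrite !inE eqxx andbT; rewrite inE in ji.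
  rewrite -(summands_min ND split' gI (subsetIl _ _) n0).
  by have [_ _ minC] := hf (f j); exact: minC gI (subsetIr _ _) n0.
split=> [i|i'].
  have [j fj] := fs i; have [i' ji] := summands_cover ND split' j.
  by exists i'; rewrite (split_block split') (same _ _ ji) fj.
have [j ji] := summands_nonempty split' i'.
by exists (f j); rewrite (split_block split') (same _ _ ji).
Qed.
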